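(* Let $E$ be a Banach space over $\mathbb{R}$ or $\mathbb{C}$, and suppose that there are closed two-sided ideals $\mathcal{N}\subsetneq\mathcal{I}\subseteq\mathcal{B}(E)$ such that $\mathcal{I}$ has codimension one in $\mathcal{B}(E)$ and $\mathcal{I}^2\subseteq\mathcal{N}$. Then $E$ does not have the uniform primary factorisation property.
   Context: $\mathcal{B}(E)$ denotes the Banach algebra of bounded linear operators on $E$ and $\mathrm{Id}_E$ the identity operator. $\mathcal{I}^2\subseteq\mathcal{N}$ means that $ST\in\mathcal{N}$ for all $S,T\in\mathcal{I}$. For $C\ge 1$, $E$ has the $C$-primary factorisation property ($C$-PFP) if for every $T\in\mathcal{B}(E)$ there are $U,V\in\mathcal{B}(E)$ with $UTV=\mathrm{Id}_E$ or $U(\mathrm{Id}_E-T)V=\mathrm{Id}_E$ and $\|U\|\,\|V\|\le C$. $E$ has the uniform primary factorisation property (UPFP) if it has the $C$-PFP for some $C\ge 1$. *)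

(* Defs.v *)
From HB Require Import structures.
From mathcomp Require Import all_boot all_order all_algebra.
From mathcomp Require Import complex.
From mathcomp Require Import all_classical all_reals all_analysis.
Set Implicit Arguments.
Unset Strict Implicit.
Unset Printing Implicit Defensive.
Import Order.TTheory GRing.Theory Num.Theory.
Import numFieldNormedType.Exports.
Local Open Scope classical_set_scope.
Local Open Scope ring_scope.

Inductive base_field := RealScalars | ComplexScalars.

Definition scalar_field (R : realType) (k : base_field) : numFieldType :=
  match k with
  | RealScalars => R
  | ComplexScalars => complex R
  end.

(* Norms take their values in the scalar field itself. In the complex case     *)
(* z <= w means that w - z is a nonnegative real, so that such a supremum is   *)
(* the usual supremum of a set of nonnegative reals.                           *)
Lemma scalar_supremums (R : realType) (k : base_field) (A : set (scalar_field R k)) :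
  A !=set0 -> (forall a, A a -> 0 <= a) -> ubound A !=set0 ->
  supremums A !=set0.
Proof.
case: k A => /= A [a0 Aa0] A0 [M AM].
  by exists (sup A); split; [apply: ub_le_sup; exists M |
    move=> u Au; apply: ge_sup => //; exists a0].
have AE a : A a -> a = (complex.Re a)%:C%C.
  by move=> /A0; rewrite lecE /= => /andP[/eqP ia _]; case: a ia => x y /= ->.
have ME u : ubound A u -> u = (complex.Re u)%:C%C.
  move=> /(_ _ Aa0); rewrite (AE _ Aa0) lecE /= => /andP[/eqP iu _].
  by case: u iu => x y /= ->.
pose B := [set complex.Re a | a in A].
have uB u : ubound A u -> ubound B (complex.Re u).
  by move=> Au _ [a Aa <-]; have := Au _ Aa; rewrite lecE => /andP[].
exists (sup B)%:C%C; split.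
  move=> a Aa; rewrite (AE _ Aa) lecR.
  by apply: ub_le_sup; [exists (complex.Re M); exact: uB | exists a].
move=> u Au; rewrite (ME _ Au) lecR; apply: ge_sup; last exact: uB.
by exists (complex.Re a0), a0.
Qed.

Section BoundedOperators.
Context (R : realType) (k : base_field).
Local Notation K := (scalar_field R k).

Record bounded_op (E : normedModType K) := BoundedOp {
  bop_fun :> E -> E;
  bop_linear : linear bop_fun;
  bop_bounded : bounded_near bop_fun (nbhs (0 : E))
}.

HB.instance Definition _ (E : normedModType K) (T : bounded_op E) :=
  GRing.isLinear.Build K E E *:%R (bop_fun T) (bop_linear T).

Context (E : normedModType K).
Implicit Types S T U : bounded_op E.

Lemma bopP S T : S =1 T -> S = T.
Proof.
case: S T => [S lS bS] [T lT bT] /= /funext ST.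
by case: T / ST lT bT => lT bT; congr BoundedOp; exact: Prop_irrelevance.
Qed.

HB.instance Definition _ := gen_eqMixin (bounded_op E).
HB.instance Definition _ := gen_choiceMixin (bounded_op E).

Lemma bop_le T : exists2 M, 0 <= M & forall x : E, `|T x| <= M * `|x|.
Proof.
have /linear_boundedP/pinfty_ex_gt0[M M0 TM] := bop_bounded T.
by exists M => //; exact: ltW.
Qed.

Lemma le_bounded (f : {linear E -> E}) (M : K) : 0 <= M ->
  (forall x, `|f x| <= M * `|x|) -> bounded_near f (nbhs (0 : E)).
Proof.
move=> M0 fM; apply/ex_bound; exists M; apply/nbhs_norm0P; exists 1 => //= x /=.
by move=> /ltW x1; rewrite (le_trans (fM x))// -[leRHS]mulr1 ler_wpM2l.
Qed.

Lemma bop0_bounded : bounded_near (\0 : E -> E) (nbhs (0 : E)).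
Proof. by apply: (@le_bounded \0 0) => // x /=; rewrite normr0 mul0r. Qed.

Lemma bopN_bounded T : bounded_near (\- T : E -> E) (nbhs (0 : E)).
Proof.
have [M M0 TM] := bop_le T.
by apply: (@le_bounded (\- T) M) => // x /=; rewrite normrN.
Qed.

Lemma bopD_bounded S T : bounded_near (S \+ T : E -> E) (nbhs (0 : E)).
Proof.
have [M M0 SM] := bop_le S; have [N N0 TN] := bop_le T.
apply: (@le_bounded (S \+ T) (M + N)) => [|x]; first exact: addr_ge0.
by rewrite /= (le_trans (ler_normD _ _))// mulrDl lerD.
Qed.

Lemma bopZ_bounded (a : K) T : bounded_near (a \*: T : E -> E) (nbhs (0 : E)).
Proof.
have [M M0 TM] := bop_le T.
apply: (@le_bounded (a \*: T) (`|a| * M)) => [|x]; first exact: mulr_ge0.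
by rewrite /= normrZ -mulrA ler_wpM2l.
Qed.

Lemma bop1_bounded : bounded_near (idfun : E -> E) (nbhs (0 : E)).
Proof. by apply: (@le_bounded idfun 1) => // x /=; rewrite mul1r. Qed.

Lemma bopM_bounded S T : bounded_near (S \o T : E -> E) (nbhs (0 : E)).
Proof.
have [M M0 SM] := bop_le S; have [N N0 TN] := bop_le T.
apply: (@le_bounded (S \o T) (M * N)) => [|x]; first exact: mulr_ge0.
by rewrite /= (le_trans (SM _))// -mulrA ler_wpM2l.
Qed.

Definition bop0 := BoundedOp (@linearP _ _ _ _ \0) bop0_bounded.
Definition bopN T := BoundedOp (@linearP _ _ _ _ (\- T)) (bopN_bounded T).
Definition bopD S T := BoundedOp (@linearP _ _ _ _ (S \+ T)) (bopD_bounded S T).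
Definition bopZ a T := BoundedOp (@linearP _ _ _ _ (a \*: T)) (bopZ_bounded a T).
Definition bop1 := BoundedOp (@linearP _ _ _ _ idfun) bop1_bounded.
Definition bopM S T := BoundedOp (@linearP _ _ _ _ (S \o T)) (bopM_bounded S T).

Let bopDA : associative bopD.
Proof. by move=> S T U; apply: bopP => x /=; rewrite addrA. Qed.
Let bopDC : commutative bopD.
Proof. by move=> S T; apply: bopP => x /=; rewrite addrC. Qed.
Let bop0D : left_id bop0 bopD.
Proof. by move=> T; apply: bopP => x /=; rewrite add0r. Qed.
Let bopND : left_inverse bop0 bopN bopD.
Proof. by move=> T; apply: bopP => x /=; rewrite addNr. Qed.

HB.instance Definition _ :=
  GRing.isZmodule.Build (bounded_op E) bopDA bopDC bop0D bopND.

Let bopZA a b T : bopZ a (bopZ b T) = bopZ (a * b) T.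
Proof. by apply: bopP => x /=; rewrite scalerA. Qed.
Let bop1Z : left_id 1 bopZ.
Proof. by move=> T; apply: bopP => x /=; rewrite scale1r. Qed.
Let bopZDr : right_distributive bopZ +%R.
Proof. by move=> a S T; apply: bopP => x /=; rewrite scalerDr. Qed.
Let bopZDl T : {morph bopZ^~ T : a b / a + b}.
Proof. by move=> a b; apply: bopP => x /=; rewrite scalerDl. Qed.

HB.instance Definition _ :=
  GRing.Zmodule_isLmodule.Build K (bounded_op E) bopZA bop1Z bopZDr bopZDl.

Let bopMA : associative bopM.
Proof. by move=> S T U; exact: bopP. Qed.
Let bop1M : left_id bop1 bopM.
Proof. by move=> T; exact: bopP. Qed.
Let bopM1 : right_id bop1 bopM.
Proof. by move=> T; exact: bopP. Qed.
Let bopMDl : left_distributive bopM +%R.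
Proof. by move=> S T U; exact: bopP. Qed.
Let bopMDr : right_distributive bopM +%R.
Proof. by move=> S T U; apply: bopP => x /=; rewrite linearD. Qed.

(* Multiplication is composition. *)
HB.instance Definition _ := GRing.Zmodule_isPzRing.Build (bounded_op E)
  bopMA bop1M bopM1 bopMDl bopMDr.

Definition opnorm T : K := supremum 0 [set `|T x| | x in [set x | `|x| <= 1]].

Let opnorm_supremums T :
  supremums [set `|T x| | x in [set x | `|x| <= 1]] (opnorm T).
Proof.
have A0 : [set `|T x| | x in [set x | `|x| <= 1]] !=set0.
  by exists `|T 0|, 0 => //=; rewrite normr0.
rewrite /opnorm /supremum ifF; last by apply/negbTE/set0P.
have [] := scalar_supremums A0.
- by move=> _ [x _ <-].
- have [M M0 TM] := bop_le T; exists M => _ [x /= x1 <-].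
  by rewrite (le_trans (TM x))// -[leRHS]mulr1 ler_wpM2l.
- by move=> s sA; exact: xgetPex (ex_intro _ s sA).
Qed.

Lemma opnorm_ge0 T : 0 <= opnorm T.
Proof.
have [/(_ 0) + _] := opnorm_supremums T; apply.
by exists 0; rewrite ?linear0 /= normr0.
Qed.

Lemma le_opnorm T x : `|T x| <= opnorm T * `|x|.
Proof.
have [->|x0] := eqVneq x 0; first by rewrite linear0 !normr0 mulr0.
have nx : 0 < `|x| by rewrite normr_gt0.
rewrite -ler_pdivrMr// mulrC.
have [ubT _] := opnorm_supremums T; apply: ubT.
by exists (`|x|^-1 *: x); rewrite /= ?linearZ normrZ normfV normr_id// mulVf// gt_eqF.
Qed.

Lemma opnorm_le T M : 0 <= M -> (forall x, `|T x| <= M * `|x|) -> opnorm T <= M.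
Proof.
move=> M0 TM; have [_] := opnorm_supremums T; apply=> _ [x /= x1 <-].
by rewrite (le_trans (TM x))// -[leRHS]mulr1 ler_wpM2l.
Qed.

Let opnormD S T : opnorm (S + T) <= opnorm S + opnorm T.
Proof.
apply: opnorm_le => [|x]; first by rewrite addr_ge0 ?opnorm_ge0.
by rewrite (le_trans (ler_normD _ _))// mulrDl lerD ?le_opnorm.
Qed.

Let opnormZ a T : opnorm (a *: T) = `|a| * opnorm T.
Proof.
have le b S : opnorm (b *: S) <= `|b| * opnorm S.
  apply: opnorm_le => [|x]; first by rewrite mulr_ge0 ?opnorm_ge0.
  by rewrite normrZ -mulrA ler_wpM2l ?le_opnorm.
apply/eqP; rewrite eq_le le /=.
have [->|a0] := eqVneq a 0; first by rewrite normr0 mul0r opnorm_ge0.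
rewrite -{1}[T]scale1r -(mulVf a0) -scalerA.
by rewrite -ler_pdivlMl ?normr_gt0// -normfV le.
Qed.

Let opnorm0_eq0 T : opnorm T = 0 -> T = 0.
Proof.
move=> T0; apply: bopP => x; apply/eqP; rewrite -normr_le0.
by rewrite (le_trans (le_opnorm T x))// T0 mul0r.
Qed.

HB.instance Definition _ :=
  Lmodule_isNormed.Build K (bounded_op E) opnormD opnormZ opnorm0_eq0.

Lemma bop_mulE S T x : (S * T) x = S (T x). Proof. by []. Qed.

Lemma bop_normE T : `|T| = opnorm T. Proof. by []. Qed.

Record two_sided_ideal (I : set (bounded_op E)) : Prop := TwoSidedIdeal {
  ideal0 : I 0;
  idealD : forall S T, I S -> I T -> I (S + T);
  idealZ : forall (a : K) T, I T -> I (a *: T);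
  idealMl : forall S T, I T -> I (S * T);
  idealMr : forall S T, I S -> I (S * T)
}.

Definition primary_factorisation (C : K) : Prop :=
  forall T : bounded_op E, exists U V : bounded_op E,
    (U * T * V = 1 \/ U * (1 - T) * V = 1) /\ `|U| * `|V| <= C.

(* In the complex case, 1 <= C forces C to be real. *)
Definition uniform_primary_factorisation : Prop :=
  exists2 C : K, 1 <= C & primary_factorisation C.

End BoundedOperators.

(* A has codimension n when the quotient V / A has a basis of n elements,      *)
(* here given by representatives b i in V.                                     *)
Definition has_codimension (K : fieldType) (V : lmodType K) (A : set V)
    (n : nat) : Prop :=
  exists b : 'I_n -> V,
    (forall c : 'I_n -> K, A (\sum_i c i *: b i) -> forall i, c i = 0) /\
    (forall v : V, exists c : 'I_n -> K, A (v - \sum_i c i *: b i)).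

(* Main.v *)
Require Import Defs.
From mathcomp Require Import all_boot all_order all_algebra.
From mathcomp Require Import all_classical all_reals all_analysis.
Import Order.TTheory GRing.Theory Num.Theory.
Import numFieldNormedType.Exports.
Local Open Scope classical_set_scope.
Local Open Scope ring_scope.

(** Since [I] is closed of codimension one, every operator is [a + A] with
    [A] in [I] and [|a|] bounded by a multiple of its norm. Fix [S] in [I]
    outside [N] and factor the identity through [t S] or [1 - t S]. As [1] is
    not in [I], it is the latter: [(a + A)(1 - t S)(b + B) = 1]. Modulo [I]
    this gives [a b = 1]; modulo [N], where all products of elements of [I]
    vanish, it gives [t S = b A + a B]. The right-hand side has norm bounded
    by a multiple of [C], uniformly in [t], so the distance from [S] to [N]
    is [0], contradicting closedness of [N]. *)

Lemma closed_dist_gt0 (K : numFieldType) (V : normedModType K) (A : set V)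
    (x : V) : closed A -> ~ A x ->
  exists2 d : K, 0 < d & forall y, A y -> d <= `|x - y|.
Proof.
move=> /closed_openC oA nAx.
have /nbhs_ballP[d /= d0 dA] : nbhs x (~` A) by exact: open_nbhs_nbhs.
exists d => // y Ay; rewrite real_leNgt ?normr_real ?gtr0_real//.
by apply/negP => xy; apply: (dA y) => //; rewrite -ball_normE.
Qed.

Section BoundedOperators.
Context (R : realType) (k : base_field).
Local Notation K := (scalar_field R k).
Context (E : normedModType K).
Local Notation Id := (1 : bounded_op E).
Implicit Types (S T U V A B : bounded_op E) (I N : set (bounded_op E)).

Lemma ideal_opp I T : two_sided_ideal I -> I T -> I (- T).
Proof. by move=> II IT; rewrite -scaleN1r; exact: idealZ. Qed.

Lemma idealB I S T : two_sided_ideal I -> I S -> I T -> I (S - T).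
Proof. by move=> II IS IT; apply: idealD => //; exact: ideal_opp. Qed.

(** An ideal containing [1] contains the representative [b ord0] as well, so [b] would not be free
    modulo [I]. *)
Lemma codim1_ideal_notin1 I : two_sided_ideal I -> has_codimension I 1 -> ~ I 1.
Proof.
move=> II [b [bfree _]] I1.
have /bfree/(_ ord0)/eqP : I (\sum_i (fun=> 1 : K) i *: b i).
  by rewrite big_ord1 scale1r -[b _]mulr1; exact: idealMl.
by rewrite oner_eq0.
Qed.

(** [1] and [T] are multiples of the same [b ord0] modulo [I], with a nonzero coefficient for [1]
    because [1] is not in [I]; [a] is the quotient of the two coefficients. *)
Lemma codim1_ideal_decomp I T : two_sided_ideal I -> has_codimension I 1 ->
  exists a : K, I (T - a *: Id).
Proof.
move=> II cI; have nI1 := codim1_ideal_notin1 I II cI.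
have [b [_ bgen]] := cI; have [c] := bgen 1; have [c'] := bgen T.
rewrite !big_ord1 => ITb I1b.
have c0 : c ord0 != 0.
  by apply: contra_notN nI1 => /eqP c0; move: I1b; rewrite c0 scale0r subr0.
exists (c' ord0 / c ord0).
have -> : T - (c' ord0 / c ord0) *: Id =
    (T - c' ord0 *: b ord0) - (c' ord0 / c ord0) *: (1 - c ord0 *: b ord0).
  by rewrite scalerBr scalerA divfK// opprB addrA subrK.
by apply: idealB => //; exact: idealZ.
Qed.

(** For nonzero [a], the operator [a^-1 *: T] differs from [1] by an element of [I], so its norm is
    at least [d]. *)
Lemma scalar_part_bound I (d : K) (a : K) T : two_sided_ideal I ->
  (forall S, I S -> d <= `|1 - S|) -> I (T - a *: Id) -> d * `|a| <= `|T|.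
Proof.
move=> II dI ITa; have [->|a0] := eqVneq a 0; first by rewrite normr0 mulr0.
have /dI : I (- (a^-1 *: (T - a *: Id))) by apply: ideal_opp => //; exact: idealZ.
rewrite opprK scalerBr scalerA mulVf// scale1r addrC subrK normrZ normfV.
by rewrite mulrC ler_pdivlMr ?normr_gt0.
Qed.

Lemma scalerMr_bop (a : K) S T : S * (a *: T) = a *: (S * T).
Proof. by apply: bopP => x; rewrite bop_mulE/= linearZ. Qed.

Lemma scalerMl_bop (a : K) S T : (a *: S) * T = a *: (S * T).
Proof. exact: bopP. Qed.

(** In the expanded product both [Id] and [S] carry the coefficient [a * b = 1]. Each term left on
    the right is a product of at least two of [A], [B], [S], hence falls into the smaller ideal once
    these three lie in [I]. *)
Lemma factor_expansion (a b : K) A B S : a * b = 1 ->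
  (A + a *: Id) * (1 - S) * (B + b *: Id) = 1 ->
  S - (b *: A + a *: B) = A * B - (A * (S * B) + b *: (A * S) + a *: (S * B)).
Proof.
move=> ab1.
have -> : (A + a *: Id) * (1 - S) * (B + b *: Id) =
    A * B + (b *: A + a *: B) + 1 -
    (A * (S * B) + b *: (A * S) + a *: (S * B) + S).
  rewrite mulrBr mulr1 mulrBl; congr (_ - _).
    rewrite mulrDl !mulrDr !(scalerMl_bop, scalerMr_bop) !(mulr1, mul1r).
    by rewrite scalerA ab1 scale1r !addrA.
  rewrite [(_ + _) * S]mulrDl mulrDl !mulrDr !(scalerMl_bop, scalerMr_bop).
  by rewrite !(mulr1, mul1r) scalerA ab1 scale1r -mulrA !addrA.
set q := b *: A + _; set r := _ + a *: _ => /eqP.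
rewrite subr_eq [1 + _]addrC => /eqP/addIr/eqP; rewrite eq_sym -subr_eq.
by move=> /eqP <-; rewrite addrAC [r + S]addrC addrK.
Qed.

(** The final bound does not involve [S], which is what allows [S] to be rescaled later. It adds two
    equal bounds, each the product of a scalar part estimate [d^-1] and an ideal part estimate
    [1 + d^-1 * |Id|]. *)
Lemma factor_through_codim1_bound I (d C : K) S U V :
  two_sided_ideal I -> has_codimension I 1 -> 0 < d ->
  (forall T, I T -> d <= `|1 - T|) -> I S ->
  U * (1 - S) * V = 1 -> `|U| * `|V| <= C ->
  exists a b : K, exists A B, [/\ I A, I B,
    S - (b *: A + a *: B) = A * B - (A * (S * B) + b *: (A * S) + a *: (S * B))
    & `|b *: A + a *: B| <= d^-1 * (1 + d^-1 * `|Id|) * C *+ 2].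
Proof.
move=> II cI d0 dI IS UV1 UVC.
have [a IA] := codim1_ideal_decomp _ U II cI.
have [b IB] := codim1_ideal_decomp _ V II cI.
have [UE VE] : U = (U - a *: Id) + a *: Id /\ V = (V - b *: Id) + b *: Id.
  by rewrite !subrK.
move: UE VE IA IB; set A := U - _; set B := V - _ => UE VE IA IB.
have ab1 : a * b = 1.
  (* Otherwise [1] is a multiple of [(1 - a * b) *: Id], which the factorisation places in [I]. *)
  apply: contrapT => /eqP ab1; apply: (codim1_ideal_notin1 I II cI).
  rewrite -[1]scale1r -(mulVf (_ : 1 - a * b != 0)) ?subr_eq0 1?eq_sym//.
  rewrite -scalerA; apply: idealZ => //.
  have -> : (1 - a * b) *: Id = A * ((1 - S) * V) + a *: (B - S * V).
    rewrite scalerBl scale1r -{1}UV1 {1}UE mulrDl mulrDl -mulrA -addrA.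
    congr (_ + _); rewrite !scalerMl_bop mul1r mulrBl mul1r -scalerA -scalerBr.
    by rewrite /B addrAC.
  apply: idealD => //; first exact: Defs.idealMr.
  by apply: idealZ => //; apply: idealB => //; exact: Defs.idealMr.
exists a, b, A, B; split => //.
  by apply: factor_expansion => //; rewrite -UE -VE.
have scal c T : I (T - c *: Id) -> `|c| <= d^-1 * `|T|.
  by move=> Tc; rewrite ler_pdivlMl//; exact: scalar_part_bound Tc.
have part c T : I (T - c *: Id) ->
    `|T - c *: Id| <= (1 + d^-1 * `|Id|) * `|T|.
  move=> Tc; rewrite (le_trans (ler_normB _ _))// mulrDl mul1r lerD2l normrZ.
  by rewrite mulrAC ler_wpM2r// scal.
have d10 : 0 <= 1 + d^-1 * `|Id|.
  by rewrite addr_ge0// mulr_ge0// invr_ge0 ltW.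
(* Stated symmetrically so as to serve both [b *: A] and [a *: B]. *)
have prod c c' T T' : I (T - c *: Id) -> I (T' - c' *: Id) ->
    `|T| * `|T'| <= C -> `|c' *: (T - c *: Id)| <=
      d^-1 * (1 + d^-1 * `|Id|) * C.
  move=> Tc Tc' TC; rewrite normrZ.
  apply: (le_trans (ler_pM _ _ (scal _ _ Tc') (part _ _ Tc))) => //.
  rewrite mulrACA ler_wpM2l//; first by rewrite mulr_ge0// invr_ge0 ltW.
  by rewrite mulrC.
rewrite mulr2n (le_trans (ler_normD _ _))// lerD//.
  exact: (prod a b U V).
by apply: (prod b a V U) => //; rewrite mulrC.
Qed.

End BoundedOperators.

Theorem proposition6p6 (R : realType) (k : base_field)
    (E : completeNormedModType (scalar_field R k)) (N I : set (bounded_op E))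
    (N_ideal : two_sided_ideal N) (N_closed : closed N)
    (I_ideal : two_sided_ideal I) (I_closed : closed I)
    (N_proper_I : N `<` I)
    (I_codim1 : has_codimension I 1)
    (I2_sub_N : forall S T : bounded_op E, I S -> I T -> N (S * T)) :
  ~ uniform_primary_factorisation E.
Proof.
move=> [C C1 fact].
have [_ /existsNP[S /not_implyP[IS nNS]]] := N_proper_I.
have nI1 := codim1_ideal_notin1 _ _ _ I I_ideal I_codim1.
have [d d0 dI] := closed_dist_gt0 _ _ _ _ I_closed nI1.
have [e e0 eN] := closed_dist_gt0 _ _ _ _ N_closed nNS.
pose M := d^-1 * (1 + d^-1 * `|1 : bounded_op E|) * C *+ 2.
have M0 : 0 <= M.
  have C0 : 0 <= C := le_trans ler01 C1.
  by rewrite mulrn_wge0// !mulr_ge0 ?addr_ge0 ?mulr_ge0// invr_ge0 ltW.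
(* Chosen so that [t * e = M + 1] exceeds [M]. *)
pose t := (M + 1) / e.
have t0 : 0 < t by rewrite divr_gt0// ltr_wpDl.
have ItS : I (t *: S) by exact: idealZ.
have [U [V [UV UVC]]] := fact (t *: S).
have {}UV : U * (1 - t *: S) * V = 1.
  (* A factorisation through [t *: S] would put [1] in [I]. *)
  case: UV => // UV; case: nI1; rewrite -UV.
  by apply: Defs.idealMr => //; exact: idealMl.
have [a [b [A [B [IA IB SE XM]]]]] :=
  factor_through_codim1_bound _ _ _ _ _ _ _ _ _ I_ideal I_codim1 d0 dI ItS UV UVC.
move: SE XM; set X := b *: A + _ => SE XM.
have NX : N (t *: S - X).
  rewrite SE; apply: idealB => //; first exact: I2_sub_N.
  by do 2?apply: idealD => //; try (apply: idealZ => //); apply: I2_sub_N => //;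
    exact: Defs.idealMr.
(* The distance bound gives [e <= t^-1 * |X|], so [M + 1 <= |X| <= M]. *)
have /eN : N (S - t^-1 *: X).
  rewrite -[S](scalerK (lt0r_neq0 t0)) -scalerBr; exact: idealZ.
rewrite opprB addrC subrK normrZ normfV gtr0_norm// ler_pdivlMl//.
rewrite divfK ?lt0r_neq0// => /le_trans/(_ XM).
by rewrite -/M gerDl ler10.
Qed.
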